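(* Let $a=-1$ and $b\in\mathbb{R}$, and consider the difference equation $x_{n+1}=\dfrac{x_{n-1}}{a+bx_nx_{n-1}}$, $n\ge 0$, with real initial conditions $(x_{-1},x_0)\in\mathbb{R}^2$; put $\alpha=bx_{-1}x_0$. Then all regular solutions are unbounded. Moreover, if $\{x_n\}$ is a regular solution, then some subsequences of $\{x_n\}$ are divergent and others converge to zero. The singular solutions are $2$-periodic if $\alpha=2$, and $4$-periodic if $\alpha=0$.
   Context: For real parameters $a,b$ and initial condition $(x_{-1},x_0)\in\mathbb{R}^2$, let $\alpha=bx_{-1}x_0$. The pair $(x_{-1},x_0)$ is an admissible initial condition if either $a=1$ and $\alpha\neq -1/n$ for all integers $n\ge 1$, or $a\ne 1$ and $\alpha\ne a^n(a-1)/(1-a^n)$ for all integers $n\geq 1$ (values of $n$ with $a^n=1$, for which the expression is undefined, impose no restriction; thus for $a=-1$ admissibility means exactly $\alpha\ne 1$). Solutions $\{x_n\}_{n\ge -1}$ with admissible initial conditions are called admissible solutions. An admissible solution is regular if $\alpha\neq 0$ and $\alpha\ne 1-a$ (for $a=-1$: $\alpha\notin\{0,2\}$); admissible solutions that are not regular are called singular. A solution is $m$-periodic if $x_{n+m}=x_n$ for all $n\ge -1$ ($m$ need not be the minimal period). *)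

(* Defs.v *)
From HB Require Import structures.
From mathcomp Require Import all_boot all_order all_algebra.
From mathcomp Require Import all_classical all_reals all_analysis.

Set Implicit Arguments.
Unset Strict Implicit.
Unset Printing Implicit Defensive.

Import Order.TTheory GRing.Theory Num.Theory.
Import numFieldNormedType.Exports.

Local Open Scope classical_set_scope.
Local Open Scope ring_scope.

(* A sequence {x_n}_{n >= -1} is represented by x : nat -> R with the index
   shifted by one: x k stands for x_{k-1}, so that the initial conditions
   x_{-1}, x_0 are x 0, x 1. *)

Definition alpha (R : realType) (b : R) (x : nat -> R) : R := b * x 0%N * x 1%N.

(* x_{n+1} = x_{n-1} / (a + b x_n x_{n-1}) for n >= 0.  MathComp division is
   total; admissibility below is what keeps the denominators nonzero. *)
Definition recurrence (R : realType) (a b : R) (x : nat -> R) : Prop :=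
  forall n : nat, x n.+2 = x n / (a + b * x n.+1 * x n).

(* The hypothesis a ^+ n <> 1 discards the n for which the forbidden value
   a^n (a - 1) / (1 - a^n) is undefined. *)
Definition admissible (R : realType) (a al : R) : Prop :=
  (a = 1 /\ forall n : nat, (1 <= n)%N -> al <> - (1 / n%:R)) \/
  (a <> 1 /\ forall n : nat, (1 <= n)%N -> a ^+ n <> 1 ->
     al <> a ^+ n * (a - 1) / (1 - a ^+ n)).

Definition admissible_solution (R : realType) (a b : R) (x : nat -> R) : Prop :=
  recurrence a b x /\ admissible a (alpha b x).

Definition regular_solution (R : realType) (a b : R) (x : nat -> R) : Prop :=
  [/\ admissible_solution a b x, alpha b x <> 0 & alpha b x <> 1 - a].

Definition singular_solution (R : realType) (a b : R) (x : nat -> R) : Prop :=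
  admissible_solution a b x /\ ~ regular_solution a b x.

Definition periodic_seq (R : realType) (m : nat) (x : nat -> R) : Prop :=
  forall n : nat, x (n + m)%N = x n.

(* Main.v *)
(** Put d = alpha - 1.  The product b x_n x_{n+1} alternates between alpha and
    alpha / (alpha - 1), so the denominators alternate between d and 1 / d, and
    x_{2k-1} = x_{-1} / d^k, x_{2k} = x_0 d^k.  Regularity says exactly
    that b, x_{-1}, x_0 are nonzero and |d| <> 1, so one of the two parity
    subsequences is a geometric progression that blows up and the other one
    tends to 0; d = 1 and d = -1 give the periodic solutions. *)

Require Import Defs.
From mathcomp Require Import all_boot all_order all_algebra.
From mathcomp Require Import all_classical all_reals all_analysis.
From mathcomp Require Import ring lra.

Set Implicit Arguments.
Unset Strict Implicit.
Unset Printing Implicit Defensive.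

Import Order.TTheory GRing.Theory Num.Theory.
Import numFieldNormedType.Exports.

Local Open Scope classical_set_scope.
Local Open Scope ring_scope.

(** A strict bound [M] would give [|c ^+ n| > |z| / M > 0] for every [n], although [c ^+ n] tends to
    0. *)
Lemma geometric_unbounded (R : realType) (z c : R) :
  z != 0 -> c != 0 -> `|c| < 1 -> ~ bounded_fun (fun n : nat => z / c ^+ n).
Proof.
move=> z0 c0 c1 /ex_strict_bound_gt0[M M0 hM].
have e0 : 0 < `|z| / M by rewrite divr_gt0 ?normr_gt0.
have /cvgr0_norm_lt/(_ _ e0)[N _ /(_ N (leqnn N)) /=] := cvg_expr c1.
have := hM N I; rewrite /= normrM normfV ltr_pdivrMr ?normr_gt0 ?expf_neq0 //.
by rewrite ltr_pdivlMr // mulrC => /lt_trans/[apply]; rewrite ltxx.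
Qed.

Lemma bounded_fun_comp (R : realType) (x : nat -> R) (f : nat -> nat) :
  bounded_fun x -> bounded_fun (x \o f).
Proof.
by move=> [M [Mr hM]]; exists M; split=> // r /hM h n _; exact: h.
Qed.

Lemma increasing_seq_affine2 (i : nat) : increasing_seq (fun n => (n.*2 + i)%N).
Proof. by move=> n m; rewrite !leEnat leq_add2r leq_double. Qed.

(** The case [n = 1] suffices: its forbidden value is (-1)(-2)/2 = 1. *)
Lemma admissible_m1 (R : realType) (al : R) : admissible (-1) al -> al - 1 != 0.
Proof.
have m11 : (-1 : R) <> 1 by lra.
case=> [[]//|[_ /(_ 1%N isT)]]; rewrite expr1 => /(_ m11) h.
apply/eqP => al1; apply: h.
have -> : al = 1 by lra.
by field.
Qed.

Lemma solution_closed_form (R : realType) (b : R) (x : nat -> R) :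
  admissible_solution (-1) b x ->
  forall k, x k.*2 = x 0%N / (alpha b x - 1) ^+ k /\
            x k.*2.+1 = x 1%N * (alpha b x - 1) ^+ k.
Proof.
move=> [rec /admissible_m1]; set d := alpha b x - 1 => d0.
elim=> [|k [IHe IHo]]; first by rewrite expr0 divr1 mulr1.
have dk0 := expf_neq0 k d0.
(* Proved first because the odd-index step divides by a denominator containing this term. Here the
   powers of [d] cancel and the denominator is -1 + alpha = [d]. *)
have even_step : x k.*2.+2 = x 0%N / d ^+ k.+1.
  rewrite rec IHe IHo.
  have -> : -1 + b * (x 1%N * d ^+ k) * (x 0%N / d ^+ k) = d.
    by rewrite {3}/d /alpha; field.
  by rewrite exprSr invfM mulrA.
split; rewrite doubleS // rec even_step IHo exprS.
(* One factor [d] survives: the product is alpha / d = (d + 1) / d. *)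
have -> : -1 + b * (x 0%N / (d * d ^+ k)) * (x 1%N * d ^+ k) = d^-1.
  have -> : b * (x 0%N / (d * d ^+ k)) * (x 1%N * d ^+ k) = (d + 1) / d.
    by rewrite {4}/d /alpha; field; rewrite d0 dk0.
  by field.
by rewrite invrK -mulrA (mulrC d).
Qed.

Lemma parity_subsequences (R : realType) (b : R) (x : nat -> R) :
  admissible_solution (-1) b x ->
  (x \o (fun n => (n.*2 + 0)%N) = fun n => x 0%N / (alpha b x - 1) ^+ n) /\
  (x \o (fun n => (n.*2 + 1)%N) = fun n => x 1%N * (alpha b x - 1) ^+ n).
Proof.
move=> /solution_closed_form h.
by split; apply/funext => n /=; rewrite ?addn0 ?addn1; case: (h n).
Qed.

(** Which parity blows up depends on whether [|d|] is below or above 1, hence the existential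
    offsets [i] and [j]. *)
Lemma regular_blowup_and_decay (R : realType) (b : R) (x : nat -> R) :
  regular_solution (-1) b x ->
  exists i j : nat, ~ bounded_fun (x \o (fun n => (n.*2 + i)%N)) /\
    x \o (fun n => (n.*2 + j)%N) @ \oo --> (0 : R).
Proof.
move=> [adm al0 al2]; have [xe xo] := parity_subsequences adm.
have [_ /admissible_m1] := adm.
set d := alpha b x - 1 in xe xo * => d0.
have x00 : x 0%N != 0.
  by apply/eqP => x0; apply: al0; rewrite /alpha x0 mulr0 mul0r.
have x10 : x 1%N != 0 by apply/eqP => x1; apply: al0; rewrite /alpha x1 mulr0.
case: (ltgtP `|d| 1) => [d1|d1|].
- exists 0%N, 1%N; rewrite xe xo; split; first exact: geometric_unbounded.
  exact: cvg_geometric.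
- have dV1 : `|d^-1| < 1 by rewrite normfV invf_lt1 ?normr_gt0.
  exists 1%N, 0%N; rewrite xe xo; split.
    (* For [|d| > 1] the ratio of modulus below 1 is [d^-1], so both progressions are rewritten in
       terms of it. *)
    have -> : (fun n => x 1%N * d ^+ n) = (fun n => x 1%N / d^-1 ^+ n).
      by apply/funext => n; rewrite exprVn invrK.
    by apply: geometric_unbounded; rewrite ?invr_neq0.
  have -> : (fun n => x 0%N / d ^+ n) = (fun n => x 0%N * d^-1 ^+ n).
    by apply/funext => n; rewrite exprVn.
  exact: cvg_geometric.
(* [d = 1] means alpha = 2 and [d = -1] means alpha = 0, both excluded by regularity. *)
- by move=> /eqP; rewrite eqr_norml => /andP[/orP[]/eqP + _];
    rewrite /d => dE; exfalso; [apply: al2|apply: al0]; lra.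
Qed.

Theorem theorem3p1 (R : realType) (b : R) :
  [/\ forall x : nat -> R, regular_solution (-1) b x -> ~ bounded_fun x,
      forall x : nat -> R, regular_solution (-1) b x ->
        (exists f : nat -> nat, increasing_seq f /\ ~ cvgn (x \o f)) /\
        (exists g : nat -> nat, increasing_seq g /\ (x \o g) @ \oo --> (0 : R)) &
      forall x : nat -> R, singular_solution (-1) b x ->
        (alpha b x = 2 -> periodic_seq 2 x) /\
        (alpha b x = 0 -> periodic_seq 4 x)].
Proof.
split=> x.
- by move=> /regular_blowup_and_decay[i [_ [unb _]]] /bounded_fun_comp.
- move=> /regular_blowup_and_decay[i [j [unb x0]]]; split.
    exists (fun n => (n.*2 + i)%N); split; first exact: increasing_seq_affine2.
    (* A convergent sequence is bounded, so the unbounded subsequence diverges. *)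
    by move=> /cvg_seq_bounded.
  by exists (fun n => (n.*2 + j)%N); split; first exact: increasing_seq_affine2.
- move=> [adm _]; have cf := solution_closed_form adm.
  (* Writing [n] as parity bit plus double, a shift by 2 or 4 keeps the parity and raises the
     exponent of [d] by 1 or 2; this changes nothing since [d = 1], respectively [d ^+ 2 = 1]. *)
  split=> al n; rewrite -[n]odd_double_half.
    have d1 : alpha b x - 1 = 1 by lra.
    rewrite d1 in cf; rewrite -addnA -[2%N]/(1.*2) -doubleD.
    by case: (odd n); rewrite ?add1n ?add0n ?(cf _).1 ?(cf _).2 !expr1n.
  have d1 : alpha b x - 1 = -1 by lra.
  rewrite d1 in cf; rewrite -addnA -[4%N]/(2.*2) -doubleD.
  by case: (odd n); rewrite ?add1n ?add0n ?(cf _).1 ?(cf _).2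
    exprD sqrrN expr1n mulr1.
Qed.
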